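(* There exist a connected graph $G$ with bounded weights and two vertices $x,y\in G$ such that the heat kernel $p$ of the lazy random walk on $G$ has the following property: the ratio $$\frac{p(x,x;t)}{p(y,y;t)}$$ does not converge as $t\to\infty$ (with $t$ ranging over the positive integers).
   Context: A (weighted) graph is a countable, undirected graph in which each edge $(u,v)$ carries a symmetric weight $w(u,v)=w(v,u)>0$, such that the total weight $\sum_{v\sim u}w(u,v)$ at every vertex $u$ is finite. ''Bounded weights'' means that the edge weights are bounded. The lazy random walk on $G$ is the discrete-time Markov chain on the vertices which, at every step, with probability $\frac12$ stays at the current vertex $u$, and with probability $\frac12$ moves to a neighbour $v$ of $u$ chosen with probability proportional to the weights, i.e. with probability $w(u,v)/\sum_{v'\sim u}w(u,v')$. The heat kernel $p(u,v;t)$ is the probability that the lazy random walk started at $u$ is at $v$ at time $t$. *)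

(* Defs.v *)
From HB Require Import structures.
From mathcomp Require Import all_boot all_order all_algebra.
From mathcomp Require Import all_classical all_reals all_analysis.

Set Implicit Arguments.
Unset Strict Implicit.
Unset Printing Implicit Defensive.

Import Order.TTheory GRing.Theory Num.Theory.
Import numFieldNormedType.Exports.

Local Open Scope classical_set_scope.
Local Open Scope ring_scope.

(** Vertices may have infinitely many neighbours.  The values of [weight] off
    the edges are unconstrained and are never used. *)
Record weighted_graph (R : realType) := WeightedGraph {
  vertex :> countType;
  adj : rel vertex;
  weight : vertex -> vertex -> R;
  adj_sym : symmetric adj;
  adj_irr : irreflexive adj;
  weight_gt0 : forall u v, adj u v -> 0 < weight u v;
  weight_sym : forall u v, adj u v -> weight u v = weight v u;
  total_weight_fin : forall u : vertex,
    (\esum_(v in [set v | adj u v]) (weight u v)%:E < +oo)%E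
}.

Section Walk.
Variables (R : realType) (G : weighted_graph R).

Definition bounded_weights : Prop :=
  exists M : R, forall u v : G, adj u v -> weight u v <= M.

Definition connected_graph : Prop :=
  forall u v : G, exists s : seq G, path (@adj R G) u s /\ last u s = v.

Definition total_weight (u : G) : R :=
  fine (\esum_(v in [set v | adj u v]) (weight u v)%:E)%E.

Definition lazy_step (u v : G) : R :=
  2^-1 * (u == v)%:R +
  2^-1 * (if adj u v then weight u v / total_weight u else 0).

(** [heat_kernel u v t] is the probability of being at [v] at time [t] when
    starting from [u], obtained by conditioning on the position [z] of the
    chain at the previous time.  The sum over [z] is at most 1, so that [fine]
    loses nothing. *)
Fixpoint heat_kernel (u v : G) (t : nat) : R :=
  if t is t'.+1 then
    fine (\esum_(z in [set: G]) (heat_kernel u z t' * lazy_step z v)%:E)%E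
  else (u == v)%:R.

End Walk.

Arguments bounded_weights {R} G.
Arguments connected_graph {R} G.

(* Main.v *)
Require Import Defs.
From HB Require Import structures.
From mathcomp Require Import all_boot all_order all_algebra.
From mathcomp Require Import all_classical all_reals all_analysis.
From mathcomp Require Import zify ring lra.

Set Implicit Arguments.
Unset Strict Implicit.
Unset Printing Implicit Defensive.

Import Order.TTheory GRing.Theory Num.Theory.
Import numFieldNormedType.Exports.

Local Open Scope classical_set_scope.
Local Open Scope ring_scope.

(** The graph is a line of levels indexed by the integers, with conductance [c k]
    between levels [k] and [k + 1], level [k] being split into [n k] vertices so
    that the edge weights stay bounded although [c] is unbounded; [x] and [y]
    are the only vertices of levels 0 and 1.  Both ends are transient.  A long
    stretch of constant conductance, placed far away on the side of [x], makes
    the sums of [z ^+ t * p(x,x;t)] diverge for some [z > 1] so close to 1 that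
    the walk killed at [x] still has a superharmonic function [h] for [z] on the
    side of [y].  Comparison with [h] bounds the sums of [z ^+ t * p(y,y;t)] by a
    constant plus a quarter of those of [z ^+ t * p(x,x;t)], so that
    [p(y,y;T) <= p(x,x;T) / 2] for some large [T].  The return probabilities at
    time [T] do not see the levels beyond distance [T], so longer stretches can
    be added further and further away on alternate sides. *)

(** * The lazy walk on a line with conductances *)

Section Chain.
Variable R : realType.
Implicit Types (c : int -> nat) (f g h : int -> R) (k j : int).

Definition mass c k : R := (c k)%:R + (c (k - 1))%:R.

(** The transition operator of the lazy walk acting on functions; edge [k] joins levels [k] and
    [k + 1]. *)
Definition step c f k : R :=
  f k / 2 + ((c k)%:R * f (k + 1) + (c (k - 1))%:R * f (k - 1)) / (2 * mass c k).

Definition delta j k : R := (k == j)%:R.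

Definition chain_kernel c t j k : R := iter t (step c) (delta k) j.

Lemma mass_gt0 c k : (forall i, (0 < c i)%N) -> 0 < mass c k.
Proof. by move=> c0; rewrite addr_gt0// ltr0n. Qed.

(** Divergence form: [f] is superharmonic at [k] exactly when the current leaving to the right is at
    least the one arriving from the left. *)
Lemma step_flux c f k : (forall i, (0 < c i)%N) ->
  step c f k = f k - ((c k)%:R * (f k - f (k + 1))
                      - (c (k - 1))%:R * (f (k - 1) - f k)) / (2 * mass c k).
Proof.
move=> c0; have /lt0r_neq0 := mass_gt0 k c0.
by rewrite /step /mass => m0; field.
Qed.

Lemma step_mono c f g k : f (k - 1) <= g (k - 1) -> f k <= g k ->
  f (k + 1) <= g (k + 1) -> step c f k <= step c g k.
Proof.
move=> l1 l2 l3; rewrite /step; apply: lerD; first by rewrite ler_pM2r.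
apply: ler_wpM2r; first by rewrite invr_ge0 mulr_ge0// addr_ge0.
by apply: lerD; exact: ler_wpM2l.
Qed.

Lemma stepZ c a f k : step c (fun i => a * f i) k = a * step c f k.
Proof. by rewrite /step; ring. Qed.

Lemma stepD c f g k : step c (fun i => f i + g i) k = step c f k + step c g k.
Proof. by rewrite /step; ring. Qed.

Lemma iter_stepZ c a f t k :
  iter t (step c) (fun i => a * f i) k = a * iter t (step c) f k.
Proof.
elim: t k => //= t IH k; rewrite -stepZ; congr step.
by apply/funext => i; rewrite IH.
Qed.

Lemma iter_stepD c f g t k : iter t (step c) (fun i => f i + g i) k =
  iter t (step c) f k + iter t (step c) g k.
Proof.
elim: t k => //= t IH k; rewrite -stepD; congr step.
by apply/funext => i; rewrite IH.
Qed.

Lemma step0 c k : step c (fun=> 0) k = 0.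
Proof. by rewrite /step !mulr0 addr0 !mul0r addr0. Qed.

Lemma iter_step_mono c f g t : (forall k, f k <= g k) ->
  forall k, iter t (step c) f k <= iter t (step c) g k.
Proof. by move=> fg; elim: t => //= t IH k; exact: step_mono. Qed.

Lemma iter_step_ge0 c f t k : (forall k, 0 <= f k) -> 0 <= iter t (step c) f k.
Proof.
move=> f0; have := iter_step_mono c t f0 k; suff -> : iter t (step c) (fun=> 0) k = 0 by [].
by elim: t k => //= t IH k; rewrite -[RHS](step0 c k); congr step; apply/funext.
Qed.

Lemma iter_step_gt0 c f t k k0 : (forall i, (0 < c i)%N) -> (forall i, 0 <= f i) ->
  0 < f k0 -> (`|k - k0| <= t)%N -> 0 < iter t (step c) f k.
Proof.
move=> c0 f0 fk0; elim: t k => [|t IH] k kt /=; first by have -> : k = k0 by lia.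
have g0 i := iter_step_ge0 c t i f0.
rewrite /step; set g := iter t _ _ in g0 IH *.
have cg i i' : 0 <= (c i)%:R * g i' by rewrite mulr_ge0 ?g0.
have [{}kt|tk] := leqP `|k - k0|%N t.
  rewrite ltr_wpDr ?divr_gt0 ?IH// divr_ge0 ?addr_ge0// mulr_ge0//.
  by rewrite ltW ?mass_gt0.
rewrite ltr_wpDl ?divr_ge0 ?g0// divr_gt0 ?mulr_gt0 ?mass_gt0//.
have [kk|kk] := leP k0 k.
  by rewrite ltr_wpDl// mulr_gt0 ?ltr0n// IH//; lia.
by rewrite ltr_wpDr// mulr_gt0 ?ltr0n// IH//; lia.
Qed.

Lemma delta_ge0 j k : 0 <= delta j k. Proof. by rewrite ler0n. Qed.

Lemma delta_refl j : delta j j = 1. Proof. by rewrite /delta eqxx. Qed.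

Lemma chain_kernel_ge0 c t j k : 0 <= chain_kernel c t j k.
Proof. by apply: iter_step_ge0 => i; exact: delta_ge0. Qed.

Lemma chain_kernel_gt0 c t j k : (forall i, (0 < c i)%N) -> (`|j - k| <= t)%N ->
  0 < chain_kernel c t j k.
Proof.
move=> c0; apply: iter_step_gt0 => //.
by rewrite delta_refl.
Qed.

(** Finite speed of propagation: each step reaches one level further. *)
Lemma iter_step_local c c' f n t k : (forall i, (`|i| <= n)%N -> c i = c' i) ->
  (t + `|k| <= n)%N -> iter t (step c) f k = iter t (step c') f k.
Proof.
move=> cc'; elim: t k => //= t IH k tk.
by rewrite /step /mass !IH ?cc'//; lia.
Qed.

(** The reflection [k -> 1 - k] swaps levels 0 and 1 and sends edge [k] to edge [- k], so one
    construction serves both sides. *)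
Lemma chain_kernel_reflect c t j k :
  chain_kernel (fun i => c (- i)) t j k = chain_kernel c t (1 - j) (1 - k).
Proof.
rewrite /chain_kernel; elim: t j => [|t IH] j /=.
  by rewrite /delta; congr (nat_of_bool _)%:R; apply/eqP/eqP; lia.
rewrite /step /mass !IH.
have -> : 1 - (j + 1) = 1 - j - 1 by ring.
have -> : 1 - (j - 1) = 1 - j + 1 by ring.
have -> : - (j - 1) = 1 - j by ring.
have -> : c (- j) = c (1 - j - 1) by congr c; ring.
by congr (_ / _ + _ / (_ * _)); [rewrite addrC | rewrite addrC].
Qed.

Lemma step_delta c k : (forall i, (0 < c i)%N) ->
  step c (delta k) = (fun i => 2^-1 * delta k i +
    ((c (k - 1))%:R / (2 * mass c (k - 1)) * delta (k - 1) i +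
     (c k)%:R / (2 * mass c (k + 1)) * delta (k + 1) i)).
Proof.
move=> c0; apply/funext => i; rewrite /step /delta.
have m0 u : mass c u != 0 by rewrite gt_eqF ?mass_gt0.
have [->|ik] := eqVneq i k.
  have -> : (k + 1 == k) = false by lia.
  have -> : (k - 1 == k) = false by lia.
  have -> : (k == k - 1) = false by lia.
  have -> : (k == k + 1) = false by lia.
  by rewrite !mulr0 !addr0 !mul0r addr0 mulr1 mul1r.
have [->|ik1] := eqVneq i (k - 1).
  have -> : (k - 1 - 1 == k) = false by lia.
  have -> : (k - 1 == k + 1) = false by lia.
  by rewrite subrK eqxx !mulr0 !addr0 add0r mul0r add0r !mulr1.
have [->|ik2] := eqVneq i (k + 1).
  have -> : (k + 1 + 1 == k) = false by lia.
  by rewrite addrK eqxx !mulr0 !add0r mul0r add0r !mulr1.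
have -> : (i + 1 == k) = false by lia.
have -> : (i - 1 == k) = false by lia.
by rewrite !mulr0 !addr0 !mul0r addr0.
Qed.

(** In the induction the walk from [j] is extended at its end, by [step_delta], and the walk from
    [k] at its start. *)
Lemma chain_kernel_reversible c t j k : (forall i, (0 < c i)%N) ->
  mass c j * chain_kernel c t j k = mass c k * chain_kernel c t k j.
Proof.
move=> c0; rewrite /chain_kernel; elim: t j k => [|t IH] j k.
  by rewrite /= /delta; have [->//|_] := eqVneq j k; rewrite !mulr0.
rewrite iterSr step_delta// 2!iter_stepD !iter_stepZ iterS.
have m0 u : mass c u != 0 by rewrite gt_eqF ?mass_gt0.
have E i : iter t (step c) (delta i) j =
    mass c i * iter t (step c) (delta j) i / mass c j.
  by rewrite -IH mulrC mulKf.
by rewrite !E /step; field; rewrite !m0.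
Qed.

End Chain.

Arguments mass {R}.
Arguments delta {R}.
Arguments chain_kernel {R}.

(** * Truncated Green functions and comparison with supersolutions *)

Section Green.
Variable R : realType.
Implicit Types (c : int -> nat) (f g h : int -> R) (k j : int).

(** Truncation at [N] keeps the sums finite for [z > 1], even where the full series diverges. *)
Definition green c (z : R) N k j : R := \sum_(t < N) z ^+ t * chain_kernel c t k j.

Lemma greenS c z N k j :
  green c z N.+1 k j = delta j k + z * step c (fun i => green c z N i j) k.
Proof.
rewrite /green big_ord_recl expr0 mul1r; congr (_ + _).
elim: N => [|N IH].
  rewrite big_ord0 (_ : (fun i => _) = fun=> 0) ?step0 ?mulr0//.
  by apply/funext => i; rewrite big_ord0.
rewrite big_ord_recr/= IH (_ : (fun i => \sum_(_ < N.+1) _) =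
  fun i => \sum_(t < N) z ^+ t * chain_kernel c t i j + z ^+ N * chain_kernel c N i j).
  rewrite stepD stepZ [in RHS]mulrDr; congr (_ + _).
  by rewrite [in RHS]mulrA; congr (_ * _); exact: exprS.
by apply/funext => i; rewrite big_ord_recr.
Qed.

Lemma green_mono c z N k j : 0 <= z -> green c z N k j <= green c z N.+1 k j.
Proof.
by move=> z0; rewrite /green big_ord_recr/= lerDl mulr_ge0 ?exprn_ge0 ?chain_kernel_ge0.
Qed.

Lemma green_ge0 c z N k j : 0 <= z -> 0 <= green c z N k j.
Proof.
by move=> z0; apply: sumr_ge0 => i _; rewrite mulr_ge0 ?exprn_ge0 ?chain_kernel_ge0.
Qed.

Lemma green_reversible c z N k j : (forall i, (0 < c i)%N) ->
  mass c k * green c z N k j = mass c j * green c z N j k.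
Proof.
move=> c0; rewrite /green !mulr_sumr; apply: eq_bigr => t _.
by rewrite mulrCA chain_kernel_reversible// mulrCA.
Qed.

(** Maximum principle, by induction on [N] through [greenS]. The comparison takes place on the
    positive levels; the left side enters only through the boundary value [green c z N 0 j], and [C]
    absorbs a source at [j > 0]. *)
Lemma green_le c z C h j N k : 0 <= z -> 0 <= C -> (forall i, 0 <= h i) ->
  h 0 = 1 -> (forall i, 0 < i -> delta j i <= C * (h i - z * step c h i)) ->
  (forall i, 0 < i -> z * step c h i <= h i) ->
  0 <= k -> green c z N k j <= (C + green c z N 0 j) * h k.
Proof.
move=> z0 C0 h0 h1 hC hz; elim: N k => [|N IH] k k0.
  by rewrite /green !big_ord0 addr0 mulr_ge0.
have [->|kn0] := eqVneq k 0; first by rewrite h1 mulr1 lerDr.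
have kp : 0 < k by lia.
set D := C + _; pose E := C + green c z N 0 j.
have ED : E <= D by rewrite lerD2l green_mono.
have CE : C <= E by rewrite lerDl green_ge0.
rewrite greenS.
have : step c (fun i => green c z N i j) k <= E * step c h k.
  by rewrite -stepZ; apply: step_mono; apply: IH; lia.
move=> /(ler_wpM2l z0) le1.
have le2 := hC _ kp; have le3 := hz _ kp.
have : C * (h k - z * step c h k) <= E * (h k - z * step c h k).
  by rewrite ler_wpM2r ?subr_ge0.
have : E * h k <= D * h k by rewrite ler_wpM2r.
by move: le1 le2; rewrite !mulrBr; lra.
Qed.

Lemma common_lower_bound (g : nat -> R) n : (forall i, (i <= n)%N -> 0 < g i) ->
  exists2 e, 0 < e & forall i, (i <= n)%N -> e <= g i.
Proof.
elim: n => [|n IH] g0.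
  by exists (g 0%N); [exact: g0|move=> i; rewrite leqn0 => /eqP->].
have [i ni|e e0 eg] := IH; first by apply: g0; exact: leqW.
exists (Num.min e (g n.+1)); first by rewrite lt_min e0 g0.
move=> i; rewrite leq_eqVlt => /orP[/eqP->|]; first by rewrite ge_min lexx orbT.
by rewrite ltnS => ni; rewrite ge_min eg.
Qed.

(** Finitely many strict inequalities leave a common slack; half of it is spent, so that strictness
    survives. *)
Lemma common_dilation (A B : nat -> R) n : (forall i, 0 <= A i < B i) ->
  exists2 z, 1 < z <= 10 / 9 & forall i, (i <= n)%N -> z * A i < B i.
Proof.
move=> AB; have [i ni|e e0 eg] := @common_lower_bound (fun i => (B i - A i) / (2 * B i)) n.
  by have := AB i => /andP[? ?]; rewrite divr_gt0 ?subr_gt0 ?mulr_gt0//; lra.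
exists (1 + Num.min e (1/9)).
  have : 0 < Num.min e (1/9) <= 1/9 by rewrite lt_min ge_min lexx orbT e0/= andbT; lra.
  by move/andP => [? ?]; apply/andP; split; lra.
move=> i ni; have /andP[Ai Bi] := AB i.
have em : Num.min e (1/9) <= e by rewrite ge_min lexx.
have : e * (2 * B i) <= B i - A i.
  by rewrite -ler_pdivlMr ?eg// mulr_gt0//; lra.
have : Num.min e (1/9) * A i <= e * A i by exact: ler_wpM2r.
have : e * A i <= e * B i by rewrite ler_wpM2l ?ltW.
by lra.
Qed.

End Green.

(** * Supersolutions on a transient half-line *)

Section Profiles.
Variable R : realType.
Implicit Types (c : int -> nat) (f : nat -> nat) (h : int -> R) (k : int).

(* Bounds the resistance from level 1 to infinity when [f] grows by the factor 4
   at each level from [K] on. *)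
Definition resistance f K : R := \sum_(1 <= i < K) (f i)%:R^-1 + 2 / (f K)%:R.

(** The values 1 and 4, imposed on both sides, give levels 0 and 1 the same mass 5. *)
Definition tame f := [/\ f 0%N = 1%N, f 1%N = 4%N, forall i, (0 < f i)%N &
  exists K, [/\ (0 < K)%N, forall i, (K <= i)%N -> f i.+1 = (4 * f i)%N &
    resistance f K < 1 / 2]].

(* A current [1 + i / K], increasing up to level [K], makes [h] strictly
   superharmonic; beyond [K], where the conductances grow by the factor 4,
   [h] is halved at each level. *)
Lemma tame_supersolution c : (forall k, (0 < c k)%N) ->
  tame (fun i : nat => c i) -> exists z C h, [/\ 1 < z, 0 <= C,
    (forall k, 0 <= h k), h 0 = 1 & [/\ h 1 <= 1 / 2,
    forall k, 0 < k -> z * step c h k <= h k &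
    forall k, 0 < k -> delta 1 k <= C * (h k - z * step c h k)]].
Proof.
move=> c0 [f0 f1 _ [K [K0 fK cap]]].
have fp i : 0 < (c i)%:R :> R by rewrite ltr0n.
have Kp : 0 < K%:R :> R by rewrite ltr0n.
pose d (i : nat) : R := 1 + i%:R / K%:R.
have d1 i : 0 < d i by rewrite ltr_wpDr ?divr_ge0.
(* The drop of [H] across an edge [i < K] carries the current [d i]; the constant 4 makes the
   current through edge [K], where [H] is halved, equal to [d K = 2]. *)
pose H (j : nat) : R := \sum_(j <= i < K) d i / (c i)%:R + 4 / (c K)%:R / 2 ^+ (j - K).
have H0 j : 0 < H j.
  rewrite /H ltr_wpDl ?divr_gt0 ?exprn_gt0// sumr_ge0// => i _.
  by rewrite divr_ge0 ?ltW.
have HS j : (j < K)%N -> H j = d j / (c j)%:R + H j.+1.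
  move=> jK; rewrite /H big_ltn// -addrA; congr (_ + (_ + _ / _ ^+ _)); lia.
have HT j : (K <= j)%N -> H j.+1 = H j / 2.
  move=> jK; rewrite /H !big_geq//; last lia.
  by rewrite !add0r subSn// exprS; field; rewrite ?expf_neq0//= gt_eqF.
have HK : H K = 4 / (c K)%:R by rewrite /H big_geq// subnn add0r divr1.
pose g k : R := H `|k|%N.
have g0 k : 0 <= g k by apply: ltW; exact: H0.
have gE (j : nat) : step c g j.+1 = H j.+1 - ((c j.+1)%:R * (H j.+1 - H j.+2)
    - (c j)%:R * (H j - H j.+1)) / (2 * ((c j.+1)%:R + (c j)%:R)).
  rewrite step_flux// /mass /g.
  have -> : j.+1%:Z - 1 = j by lia.
  have -> : j.+1%:Z + 1 = j.+2 by lia.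
  by [].
have dS j : d j < d j.+1 by rewrite ltrD2l ltr_pM2r ?invr_gt0// ltr_nat.
have flux j : (j < K)%N -> (c j)%:R * (H j - H j.+1) = d j.
  by move=> jK; rewrite HS// addrK mulrC divfK// gt_eqF.
(* The uniform contraction 9/10 allows any [z] up to 10/9 beyond [K], which leaves finitely many
   levels to [common_dilation]. *)
have tail j : (K <= j)%N -> step c g j.+1 = 9 / 10 * H j.+1.
  move=> jK; rewrite gE (HT j.+1); last lia.
  rewrite (_ : H j = 2 * H j.+1); last by rewrite HT//; field.
  rewrite (fK j)// natrM; field.
  by rewrite gt_eqF //=; rewrite -[X in _ + X]mul1r -mulrDl mulr_gt0//.
have strict j : step c g j.+1 < H j.+1.
  have [jK|jK] := leqP K j; first by rewrite tail//; have := H0 j.+1; lra.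
  rewrite gE gtrBl; apply: divr_gt0; last by rewrite mulr_gt0 ?addr_gt0.
  rewrite subr_gt0 (flux _ jK).
  have [jK1|] := ltnP j.+1 K; first by rewrite flux.
  move=> Kj; have {Kj} jE : j.+1 = K by lia.
  rewrite (HT j.+1) ?jE// HK.
  rewrite [ltRHS](_ : _ = 2); last by field; rewrite gt_eqF.
  apply: (lt_le_trans (dS j)); rewrite jE /d divff ?gt_eqF//; lra.
have [|z /andP[z1 z9] zK] := @common_dilation _ (fun j => step c g j.+1) (fun j => H j.+1) K.
  move=> j; rewrite strict andbT; exact: (iter_step_ge0 c 1).
have zg j : z * step c g j.+1 <= H j.+1.
  have [jK|jK] := leqP j K; first exact/ltW/zK.
  rewrite tail; last exact: ltnW.
  have : z * H j.+1 <= 10 / 9 * H j.+1 by rewrite ler_wpM2r// ltW.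
  by lra.
have H01 : H 0%N = 1 + H 1%N by rewrite HS// f0 /d mul0r addr0 divr1.
(* Since [d <= 2] up to [K], [H 1] is at most twice the resistance; with [H 0 = 1 + H 1] the
   normalised value at level 1 is then at most 1/2. *)
have H1 : H 1%N < 1.
  apply: (@le_lt_trans _ _ (2 * resistance (fun i => c i) K)); last by move: cap; lra.
  rewrite /H /resistance (_ : (1 - K)%N = 0%N); last lia.
  rewrite divr1 mulrDr mulr_sumr; apply: lerD; last by lra.
  rewrite big_nat_cond [leRHS]big_nat_cond; apply: ler_sum => i.
  rewrite andbT => /andP[_ iK]; rewrite ler_pM2r ?invr_gt0// /d.
  have : i%:R / K%:R <= 1 :> R by rewrite ler_pdivrMr// mul1r ler_nat ltnW.
  by lra.
have z1s : 0 < H 1%N - z * step c g 1 by rewrite subr_gt0 (zK 0%N).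
have H0i : 0 < (H 0%N)^-1 by rewrite invr_gt0.
(* [C] is the inverse of the defect of the normalised function at level 1. *)
exists z, (H 0%N / (H 1%N - z * step c g 1)), (fun k => (H 0%N)^-1 * g k).
split => //; first by rewrite divr_ge0// ltW.
- by move=> k; rewrite mulr_ge0 ?g0 ?(ltW H0i).
- by rewrite /g mulVf// gt_eqF.
split.
- by rewrite /g mulrC ler_pdivrMr// H01; lra.
- move=> [[|j]|j]// _; rewrite stepZ mulrCA ler_pM2l//; exact: zg.
- move=> [[|j]|j]// _; rewrite stepZ mulrCA -mulrBr mulrACA divff ?gt_eqF// mul1r.
  rewrite /delta; have [->|_] := eqVneq j.+1%:Z 1.
    by rewrite mulVf// gt_eqF.
  by rewrite mulr_ge0 ?invr_ge0 ?subr_ge0 ?(ltW z1s)// zg.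
Qed.

End Profiles.

Arguments tame R f : clear implicits. Arguments resistance {R}.

(** * Long stretches of constant conductance *)

Section Stretches.
Variable R : realType.
Implicit Types (c : int -> nat) (f : nat -> nat) (h : int -> R) (k : int).

(** Raising the threshold by one replaces [2 / f K] by [1 / f K + 2 / (4 * f K)], which is
    smaller. *)
Lemma tame_threshold f m : tame R f -> exists K, [/\ (m <= K)%N, (0 < K)%N,
  forall i, (K <= i)%N -> f i.+1 = (4 * f i)%N & resistance f K < 1 / 2 :> R].
Proof.
move=> [_ _ f0 [K [K0 fK cap]]].
elim: m => [|m [L [mL L0 fL capL]]]; first by exists K.
exists L.+1; split => //; first by move=> i /ltnW; exact: fL.
apply: le_lt_trans capL; rewrite /resistance big_nat_recr//= (fL L)// natrM.
have fp : 0 < (f L)%:R :> R by rewrite ltr0n.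
rewrite -addrA lerD2l invfM mulrA.
by have : 0 < (f L)%:R^-1 :> R; [rewrite invr_gt0|lra].
Qed.

Lemma tame_stretch f n M : tame R f -> exists g, [/\ tame R g,
  forall i, (i <= n)%N -> g i = f i & exists p C, (M < p)%N /\
  forall i, (p <= i + M)%N -> (i <= p + M)%N -> g i = C].
Proof.
move=> tf; have [K [nK K0 fK cap]] := tame_threshold n.+1 tf.
have [f0 f1 fp _] := tf.
(* [L] edges of conductance [C] follow edge [K]. The new end of the resistance bound is
   [1 / f K + (L - 1) / C + 2 / C = 2 / f K], the same as before. *)
pose L := (2 * M + 1)%N; pose C := (f K * (L + 1))%N.
have Cp : (0 < C)%N by rewrite muln_gt0 fp addn1.
pose g i := if (i <= K)%N then f i else (C * 4 ^ (i - (K + L)))%N.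
exists g; split.
- split; rewrite /g ?K0//.
    by move=> i; case: ifP => // _; rewrite muln_gt0 Cp expn_gt0.
  exists (K + L)%N; split; first lia.
    move=> i iK; have -> : (i.+1 <= K)%N = false by lia.
    have -> : (i <= K)%N = false by rewrite /L in iK *; lia.
    by rewrite subSn// expnS mulnCA.
  apply: le_lt_trans cap; rewrite /resistance.
  rewrite (big_cat_nat (n := K)) ?leq_addr//= -addrA; apply: lerD.
    rewrite big_nat_cond [leRHS]big_nat_cond; apply: ler_sum => i.
    by rewrite andbT => /andP[_ /ltnW ->].
  rewrite big_ltn; last by rewrite /L; lia.
  rewrite leqnn (_ : (K + L <= K)%N = false); last by rewrite /L; lia.
  rewrite subnn expn0 muln1.
  rewrite (eq_big_nat _ _ (F2 := fun=> (C%:R)^-1)); last first.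
    move=> i /andP[Ki iL]; rewrite leqNgt Ki/=.
    by have -> : (i - (K + L) = 0)%N; [lia|rewrite expn0 muln1].
  rewrite sumr_const_nat -addrA -(mulr_natl C%:R^-1) -mulrDl.
  have -> : (K + L - K.+1)%:R + 2 = (L + 1)%:R :> R.
    by rewrite -natrD; congr _%:R; rewrite /L; lia.
  have fKp : (f K)%:R != 0 :> R by rewrite pnatr_eq0 -lt0n.
  have Lp : (L + 1)%:R != 0 :> R by rewrite pnatr_eq0 addn1.
  rewrite /C natrM invfM mulrCA divff// mulr1.
  by rewrite mulr2n mulrDl mul1r.
- by move=> i iN; rewrite /g (_ : (i <= K)%N)//; lia.
- exists (K + M + 1)%N, C; split; first lia.
  move=> i i1 i2; rewrite /g; have -> : (i <= K)%N = false by lia.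
  by have -> : (i - (K + L) = 0)%N; [rewrite /L; lia|rewrite expn0 muln1].
Qed.

(** The subtraction is truncated, so the function vanishes at distance [M] and beyond. *)
Definition tent (M : nat) (p k : int) : R := (M - `|k - p|%N)%:R.

Lemma tent_ge0 M p k : 0 <= tent M p k. Proof. by rewrite ler0n. Qed.

(** Away from [p] the tent is convex; at the peak one step lowers [M] to [M - 1 / 2], which the
    factor [z] makes up for. *)
Lemma tent_subsolution c (z : R) M p C k : 1 <= z -> M%:R <= z * (M%:R - 1 / 2) ->
  (forall i, (0 < c i)%N) -> (forall i, (`|i - p| <= M)%N -> c i = C) ->
  tent M p k <= z * step c (tent M p) k.
Proof.
move=> z1 zM c0 cC; have z0 : 0 <= z by lra.
have s0 : 0 <= step c (tent M p) k by apply: (iter_step_ge0 c 1) => i; exact: tent_ge0.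
have [kM|Mk] := ltnP `|k - p| M; last first.
  by rewrite /tent; have -> : (M - `|(k - p)%R| = 0)%N; [lia|rewrite mulr_ge0].
have Cp : 0 < C%:R :> R by rewrite ltr0n -(cC k) ?c0//; lia.
have -> : step c (tent M p) k =
    tent M p k / 2 + (tent M p (k + 1) + tent M p (k - 1)) / 4.
  by rewrite /step /mass !cC; [field; rewrite gt_eqF|lia|lia]; lra.
have [kp|kp] := eqVneq k p.
  have M0 : (0 < M)%N by lia.
  rewrite /tent kp subrr subn0.
  have -> : (M - `|(p + 1 - p)%R| = M.-1)%N by lia.
  have -> : (M - `|(p - 1 - p)%R| = M.-1)%N by lia.
  apply: le_trans zM _; rewrite ler_wpM2l//.
  by rewrite (_ : M%:R = M.-1%:R + 1 :> R); [lra|rewrite natr1 prednK].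
rewrite -[leLHS]mul1r; apply: ler_pM => //.
have : 2 * tent M p k <= tent M p (k + 1) + tent M p (k - 1).
  by rewrite /tent -natrM -natrD ler_nat; lia.
by lra.
Qed.

(** The walk goes to [p] in [|p|] steps, stays under the tent at a cost offset by powers of [z], and
    returns to 0 in [n] steps. *)
Lemma chain_kernel_lower_bound c (z : R) M p C : 1 < z -> M%:R <= z * (M%:R - 1 / 2) ->
  (forall i, (0 < c i)%N) -> (forall i, (`|i - p| <= M)%N -> c i = C) ->
  exists n, exists2 e, 0 < e & forall t, (n <= t)%N -> e <= z ^+ t * chain_kernel c t 0 0.
Proof.
move=> z1 zM c0 cC; have z0 : 0 <= z by lra.
have M0 : (0 < M)%N by rewrite lt0n; apply/eqP => M0; move: zM; rewrite M0; lra.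
have Mp : 0 < M%:R :> R by rewrite ltr0n.
pose n := (`|p| + M)%N.
pose u k := chain_kernel c n k (0 : int) : R.
have u0 k : 0 <= u k by exact: chain_kernel_ge0.
(* The minimum treats both signs of the level at once; dividing by [M], the height of the tent,
   gives [e * tent <= u]. *)
have [|e e0 eu] := @common_lower_bound _ (fun i => Num.min (u i) (u (- i%:Z)) / M%:R) n.
  by move=> i iN; rewrite divr_gt0// lt_min !chain_kernel_gt0//; lia.
have low k : e * tent M p k <= u k.
  have [kM|Mk] := ltnP `|k - p| M; last first.
    by rewrite /tent; have -> : (M - `|(k - p)%R| = 0)%N; [lia|rewrite mulr0].
  have : e * M%:R <= u k.
    have kn : (`|k| <= n)%N by rewrite /n; lia.
    rewrite -ler_pdivlMr//; apply: le_trans (eu _ kn) _.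
    rewrite ler_pM2r ?invr_gt0// ge_min.
    case: k {kn kM} => k; apply/orP; [by left|right].
    by rewrite NegzE abszN.
  by apply: le_trans; rewrite ler_pM2l// ler_nat; lia.
have grow s k : tent M p k <= z ^+ s * iter s (step c) (tent M p) k.
  elim: s k => [|s IH] k; first by rewrite mul1r.
  apply: le_trans (tent_subsolution k (ltW z1) zM c0 cC) _.
  by rewrite exprS -mulrA ler_wpM2l//= -stepZ; exact: step_mono.
pose v := iter `|p|%N (step c) (tent M p) 0.
have v0 : 0 < v.
  apply: (iter_step_gt0 (k0 := p)) => //; first by rewrite /tent subrr subn0.
  lia.
exists (n + `|p|)%N; exists (e * v); first exact: mulr_gt0.
move=> t nt; have -> : t = (`|p| + ((t - (n + `|p|)) + n))%N by lia.
move: (t - _)%N => s {nt t}.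
have zp m : 1 <= z ^+ m by rewrite exprn_ege1// ltW.
have Ev : e * v <= z ^+ s * iter `|p| (step c) (iter s (step c) u) 0.
  rewrite -!iter_stepZ; apply: iter_step_mono => k.
  rewrite -iter_stepZ.
  apply: (@le_trans _ _ (z ^+ s * (e * iter s (step c) (tent M p) k))).
    by rewrite mulrCA ler_pM2l.
  by rewrite iter_stepZ ler_wpM2l ?exprn_ge0// -iter_stepZ; exact: iter_step_mono.
apply: le_trans Ev _.
have -> : chain_kernel c (`|p| + (s + n)) 0 0 = iter `|p| (step c) (iter s (step c) u) 0.
  by rewrite /chain_kernel iterD (iterD s).
rewrite ler_wpM2r//; last by rewrite ler_weXn2l ?(ltW z1)//; lia.
by apply: iter_step_ge0 => k; exact: iter_step_ge0.
Qed.

End Stretches.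

(** * Construction of the oscillating conductances *)

Section Oscillation.
Variable R : realType.
Implicit Types (c : int -> nat) (k : int).

(** If [b t > a t / 2] for all large [t], the sum of [b - a / 4] eventually gains at least [e / 4]
    per term and exceeds [D]. *)
Lemma term_le_half (a b : nat -> R) D e n m : 0 < e ->
  (forall t, (n <= t)%N -> e <= a t) ->
  (forall N, \sum_(t < N) b t <= D + (\sum_(t < N) a t) / 4) ->
  exists2 T, (m <= T)%N & b T <= a T / 2.
Proof.
move=> e0 ea sba; apply: contrapT => nT.
have ab t : (m <= t)%N -> a t / 2 < b t.
  by move=> mt; rewrite ltNge; apply/negP => ?; apply: nT; exists t.
pose s N := \sum_(t < N) b t - (\sum_(t < N) a t) / 4.
have sD N : s N <= D by rewrite lerBlDr.
have grow i : s (maxn n m) + i%:R * (e / 4) <= s (maxn n m + i)%N.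
  elim: i => [|i IH]; first by rewrite mul0r addr0 addn0.
  rewrite addnS {2}/s !big_ord_recr/= -natr1.
  have := ea (maxn n m + i)%N ltac:(lia); have := ab (maxn n m + i)%N ltac:(lia).
  move: IH; rewrite {2}/s; lra.
have e4 : 0 < e / 4 by rewrite divr_gt0.
set x := (D - s (maxn n m)) / (e / 4).
have := grow (Num.bound x); apply/negP; rewrite -ltNge.
apply: le_lt_trans (sD _) _; rewrite -ltrBlDl -ltr_pdivrMr//.
by apply: archi_boundP; rewrite divr_ge0 ?subr_ge0 ?sD// ltW.
Qed.

Definition tame_chain c := [/\ forall k, (0 < c k)%N,
  tame R (fun i : nat => c i) & tame R (fun i : nat => c (- i%:Z))].

Lemma tame_chain_reflect c : tame_chain c -> tame_chain (fun k => c (- k)).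
Proof.
move=> [c0 tr tl]; split => //; rewrite (_ : (fun _ => _) = fun i : nat => c i)//.
by apply/funext => i; rewrite opprK.
Qed.

(** [z] and [h] depend on the right side alone, so they are fixed before the stretch is inserted on
    the left. *)
Lemma favour_origin c n : tame_chain c -> exists c', [/\ tame_chain c',
  forall k, (`|k| <= n)%N -> c' k = c k & exists2 T, (n <= T)%N &
  chain_kernel c' T 1 1 <= chain_kernel c' T 0 0 / 2 :> R].
Proof.
move=> [c0 tr tl].
have [z [C [h [z1 C0 h0 h00 [h1 zh zhC]]]]] := tame_supersolution c0 tr.
have z0 : 0 <= z by lra.
(* The condition [zM] is [M >= z / (2 * (z - 1))] rearranged. *)
pose M := Num.bound (z / 2 / (z - 1)).
have zM : M%:R <= z * (M%:R - 1 / 2).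
  have : z / 2 / (z - 1) < M%:R by apply: archi_boundP; rewrite !divr_ge0//; lra.
  by rewrite ltr_pdivrMr; lra.
have [g [tg gc [p [A [Mp gA]]]]] := tame_stretch n M tl.
have [g1 g4 g0 _] := tg; have [r1 r4 _ _] := tr.
pose c' k := if 0 <= k then c k else g `|k|%N.
have cr (i : nat) : c' i = c i by [].
have cl (i : nat) : c' (- i%:Z) = g i.
  by case: i => [|i]; [rewrite g1 -r1|rewrite -NegzE].
have c'0 k : (0 < c' k)%N by rewrite /c'; case: ifP.
have c'n k : (`|k| <= n)%N -> c' k = c k.
  rewrite /c'; case: ifP => // k0 kn; rewrite gc//; congr c; lia.
have same k : 0 < k -> step c' h k = step c h k.
  move=> kp; rewrite /step /mass /c'.
  by have -> : 0 <= k; [lia|have -> : 0 <= k - 1 by lia].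
exists c'; split => //.
  split=> //.
  by rewrite (funext cl : (fun i : nat => c' (- i%:Z)) = g).
have [|n1 [e e0 He]] := @chain_kernel_lower_bound R c' z M (- p%:Z) A z1 zM c'0.
  by move=> i ip; rewrite /c'; case: ifP => i0; [lia|apply: gA; lia].
have [|T nT HT] := @term_le_half (fun t => z ^+ t * chain_kernel c' t 0 0)
    (fun t => z ^+ t * chain_kernel c' t 1 1) (C / 2) e n1 n e0 He.
  move=> N; rewrite -/(green c' z N 1 1) -/(green c' z N 0 0).
  (* Both comparisons gain [h 1 <= 1 / 2]; linked by [le01], which rests on the equal masses of
     levels 0 and 1, they give [C / 2] plus a quarter of [green c' z N 0 0]. *)
  have le11 : green c' z N 1 1 <= (C + green c' z N 0 1) * h 1.
    by apply: green_le => // i ip; rewrite same//; [exact: zhC|exact: zh].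
  have le10 : green c' z N 1 0 <= (0 + green c' z N 0 0) * h 1.
    apply: green_le => // i ip; rewrite ?same//; last exact: zh.
    by rewrite mul0r /delta (_ : (i == 0) = false)//; lia.
  have le01 : green c' z N 0 1 = green c' z N 1 0.
    have := green_reversible z N 1 0 c'0; rewrite /mass subrr sub0r.
    rewrite (cl 1%N) (cr 1%N) (cr 0%N) g4 r4 r1 => E.
    by move: E; lra.
  have := green_ge0 c' N 0 0 z0; have := green_ge0 c' N 0 1 z0.
  move=> p01 p00; have hh := h0 1.
  have : (C + green c' z N 0 1) * h 1 <= (C + green c' z N 0 1) * (1 / 2).
    by rewrite ler_wpM2l ?addr_ge0.
  have : (0 + green c' z N 0 0) * h 1 <= (0 + green c' z N 0 0) * (1 / 2).
    by rewrite ler_wpM2l ?addr_ge0.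
  by move: le11 le10; rewrite le01; lra.
exists T => //; move: HT; rewrite -mulrA ler_pM2l// exprn_gt0//; lra.
Qed.

Lemma favour_both c n : tame_chain c -> exists c', [/\ tame_chain c',
  forall k, (`|k| <= n)%N -> c' k = c k & exists T1 T2, [/\ (n <= T1)%N, (n <= T2)%N,
  chain_kernel c' T1 1 1 <= chain_kernel c' T1 0 0 / 2 :> R &
  chain_kernel c' T2 0 0 <= chain_kernel c' T2 1 1 / 2 :> R]].
Proof.
move=> /(favour_origin n)[c1 [t1 c1E [T1 nT1 K1]]].
(* The second change keeps everything that the return probabilities at time [T1] can see. *)
have [c2 [t2 c2E [T2 nT2 K2]]] := favour_origin (n + T1 + 2) (tame_chain_reflect t1).
pose c3 k := c2 (- k).
have c3E k : (`|k| <= n + T1 + 2)%N -> c3 k = c1 k.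
  by move=> kn; rewrite /c3 c2E ?opprK//; lia.
exists c3; split; first exact: tame_chain_reflect.
  by move=> k kn; rewrite c3E ?c1E//; lia.
exists T1, T2; split => //; first lia.
  rewrite /chain_kernel !(@iter_step_local _ c3 c1 _ (n + T1 + 2)) //; lia.
have E j : chain_kernel c2 T2 j j = chain_kernel c3 T2 (1 - j) (1 - j) :> R.
  rewrite -chain_kernel_reflect; congr (chain_kernel _ _ _ _).
  by apply/funext => k; rewrite /c3 opprK.
by move: K2; rewrite !E subrr subr0.
Qed.

Lemma tame_chain_exists : tame_chain (fun k => 4 ^ `|k|)%N.
Proof.
have t4 : tame R (fun i => 4 ^ i)%N.
  split => // [i|]; first by rewrite expn_gt0.
  (* The threshold 1 would give exactly 1/2; the threshold 2 gives 3/8. *)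
  exists 2%N; split => //; first by move=> i _; rewrite expnS.
  by rewrite /resistance big_nat1 !natrX; lra.
split; first by move=> k; rewrite expn_gt0.
  by rewrite (_ : (fun _ => _) = fun i => (4 ^ i)%N).
by rewrite (_ : (fun _ => _) = fun i => (4 ^ i)%N)//; apply/funext => i; rewrite abszN.
Qed.

(** The recursion carries a chain together with a radius within which it stays frozen; each new
    radius exceeds the times just obtained. *)
Lemma oscillating_chain : exists c, [/\ forall k, (0 < c k)%N, c 0 = 1%N &
  forall n, exists T1 T2, [/\ (n <= T1)%N, (n <= T2)%N,
  chain_kernel c T1 1 1 <= chain_kernel c T1 0 0 / 2 :> R &
  chain_kernel c T2 0 0 <= chain_kernel c T2 1 1 / 2 :> R]].
Proof.
have next (s : (int -> nat) * nat) : {s' : (int -> nat) * nat | tame_chain s.1 ->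
    [/\ tame_chain s'.1, (s.2 < s'.2)%N,
    forall k, (`|k| <= s.2)%N -> s'.1 k = s.1 k & exists T1 T2, [/\ (s.2 <= T1)%N,
    (s.2 <= T2)%N, (maxn T1 T2 + 2 <= s'.2)%N,
    chain_kernel s'.1 T1 1 1 <= chain_kernel s'.1 T1 0 0 / 2 :> R &
    chain_kernel s'.1 T2 0 0 <= chain_kernel s'.1 T2 1 1 / 2 :> R]]}.
  apply: cid; have [ts|nts] := pselect (tame_chain s.1); last by exists s.
  have [c' [tc' ec' [T1 [T2 [n1 n2 K1 K2]]]]] := favour_both s.2 ts.
  exists (c', (s.2 + T1 + T2 + 2)%N) => _; split => //=; first lia.
  by exists T1, T2; split => //; lia.
pose s n := iter n (fun s => sval (next s)) (fun k => (4 ^ `|k|)%N, 1%N).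
have ts n : tame_chain (s n).1.
  elim: n => [|n IH]; first exact: tame_chain_exists.
  by rewrite /s iterS -/(s n); case: (next _) => /= s' /(_ IH)[].
have sS n : [/\ ((s n).2 < (s n.+1).2)%N,
    forall k, (`|k| <= (s n).2)%N -> (s n.+1).1 k = (s n).1 k &
    exists T1 T2, [/\ ((s n).2 <= T1)%N, ((s n).2 <= T2)%N,
    (maxn T1 T2 + 2 <= (s n.+1).2)%N,
    chain_kernel (s n.+1).1 T1 1 1 <= chain_kernel (s n.+1).1 T1 0 0 / 2 :> R &
    chain_kernel (s n.+1).1 T2 0 0 <= chain_kernel (s n.+1).1 T2 1 1 / 2 :> R]].
  by have [] := svalP (next (s n)) (ts n).
have ns n : (n < (s n).2)%N.
  by elim: n => // n IH; have [lt _ _] := sS n; exact: leq_ltn_trans IH lt.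
have mono n i : ((s n).2 <= (s (n + i)%N).2)%N /\
    forall k, (`|k| <= (s n).2)%N -> (s (n + i)%N).1 k = (s n).1 k.
  elim: i => [|i [l1 IH]]; first by rewrite addn0.
  rewrite addnS; have [/ltnW l2 E _] := sS (n + i)%N.
  split; first exact: leq_trans l1 l2.
  by move=> k kn; rewrite E ?IH//; exact: leq_trans kn l1.
(* The diagonal limit: the radius at stage [n] exceeds [n], so level [k] is settled from stage [|k|]
   on. *)
pose c k := (s `|k|%N).1 k.
have cE n k : (`|k| <= (s n).2)%N -> c k = (s n).1 k.
  move=> kn; rewrite /c; have [le|/ltnW le] := leqP n `|k|.
    by have [_ E] := mono n (`|k| - n)%N; rewrite -E// subnKC.
  have [_ E] := mono `|k|%N (n - `|k|)%N; rewrite subnKC// in E.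
  by rewrite E// ltnW.
exists c; split.
- by move=> k; rewrite /c; have [] := ts `|k|%N.
- by rewrite /c; have [_ []] := ts `|0|%N.
move=> n; have [_ _ [T1 [T2 [n1 n2 n12 K1 K2]]]] := sS n.
have kE T j : (T + 2 <= (s n.+1).2)%N -> (`|j| <= 1)%N ->
    chain_kernel c T j j = chain_kernel (s n.+1).1 T j j :> R.
  move=> Ts j1; apply: (@iter_step_local _ _ _ _ (s n.+1).2); last lia.
  by move=> i; exact: cE.
have := ns n => nsn.
exists T1, T2; split; [lia|lia| |]; rewrite !kE//; lia.
Qed.

End Oscillation.
Arguments tame_chain R c : clear implicits.

(** * Splitting the levels into vertices *)

Section Blowup.
Variables (R : realType) (c n : int -> nat).
Hypotheses (c0 : forall k, (0 < c k)%N) (n0 : forall k, (0 < n k)%N).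

Definition blowup := {k : int & 'I_(n k)}.

Lemma esum_levels (s : seq int) (F : blowup -> R) : uniq s ->
  (forall v, 0 <= F v) ->
  (\esum_(v in [set v : blowup | tag v \in s]) (F v)%:E =
  (\sum_(k <- s) \sum_(i < n k) F (Tagged (fun k => 'I_(n k)) i))%:E)%E.
Proof.
move=> us F0.
pose r := [seq Tagged (fun k => 'I_(n k)) i | k <- s, i <- enum 'I_(n k)].
have -> : [set v : blowup | tag v \in s] = [set` r].
  apply/seteqP; split => [[k i] /= ks|_ /= /allpairsPdep[k [i [ks _ ->]]]] //.
  by apply/allpairsPdep; exists k, i; split => //; exact: mem_enum.
rewrite esum_fset; [|exact: finite_seq|by move=> *; rewrite lee_fin].
rewrite -fsbig_seq ?sumEFin//; last first.
  apply: allpairs_uniq_dep => //; first by move=> k _; exact: enum_uniq.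
  by move=> [k i] [l j] _ _.
congr _%:E; rewrite big_allpairs_dep; apply: eq_bigr => k _.
by rewrite big_enum.
Qed.

Lemma sum_levels (s : seq int) (f : int -> R) :
  \sum_(k <- s) \sum_(i < n k) f k = \sum_(k <- s) (n k)%:R * f k.
Proof.
by apply: eq_bigr => k _; rewrite sumr_const card_ord mulr_natl.
Qed.

Lemma singleton_level (u v : blowup) : n (tag u) = 1%N -> tag v = tag u -> u = v.
Proof.
case: u v => [k i] [l j] /= nk lk; subst l; congr existT; apply/val_inj => /=.
by have := ltn_ord i; have := ltn_ord j; move: nk; lia.
Qed.

Definition blowup_adj (u v : blowup) := tag v \in [:: tag u + 1; tag u - 1].

(** The conductance of an edge, indexed by its lower level, is shared equally by the complete
    bipartite graph between the two levels. *)
Definition blowup_weight (u v : blowup) : R :=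
  (c (Num.min (tag u) (tag v)))%:R / ((n (tag u))%:R * (n (tag v))%:R).

Lemma blowup_adj_sym : symmetric blowup_adj.
Proof. by move=> u v; rewrite /blowup_adj !inE; apply/orP/orP; lia. Qed.

Lemma blowup_adj_irr : irreflexive blowup_adj.
Proof. by move=> u; rewrite /blowup_adj !inE; lia. Qed.

Lemma blowup_weight_gt0 u v : 0 < blowup_weight u v.
Proof. by rewrite divr_gt0 ?mulr_gt0 ?ltr0n. Qed.

Lemma blowup_weight_sym u v : blowup_weight u v = blowup_weight v u.
Proof. by rewrite /blowup_weight minC [X in _ / X]mulrC. Qed.

Lemma blowup_total_weight u :
  (\esum_(v in [set v | blowup_adj u v]) (blowup_weight u v)%:E =
   (mass c (tag u) / (n (tag u))%:R)%:E)%E.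
Proof.
have nn k : (n k)%:R != 0 :> R by rewrite pnatr_eq0 -lt0n.
rewrite esum_levels; last by move=> v; exact/ltW/blowup_weight_gt0.
  rewrite (sum_levels _ (fun k => (c (Num.min (tag u) k))%:R /
    ((n (tag u))%:R * (n k)%:R))) !big_cons big_nil.
  rewrite min_l; last lia.
  rewrite min_r; last lia.
  by congr _%:E; rewrite /mass; field; rewrite !nn.
by rewrite /= !inE; lia.
Qed.

Lemma blowup_total_weight_fin u :
  (\esum_(v in [set v | blowup_adj u v]) (blowup_weight u v)%:E < +oo)%E.
Proof. by rewrite blowup_total_weight ltry. Qed.

Definition blowup_graph : weighted_graph R :=
  @WeightedGraph R blowup blowup_adj blowup_weight blowup_adj_sym
    blowup_adj_irr (fun u v _ => blowup_weight_gt0 u v)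
    (fun u v _ => blowup_weight_sym u v) blowup_total_weight_fin.

Lemma blowup_bounded : (forall k, (c k <= n k * n (k + 1))%N) ->
  bounded_weights blowup_graph.
Proof.
move=> cn; exists 1 => u v; rewrite /= /blowup_adj !inE => uv.
rewrite /blowup_weight ler_pdivrMr ?mulr_gt0 ?ltr0n// mul1r -natrM ler_nat.
case/orP: uv => /eqP->.
  by rewrite min_l//; lia.
rewrite min_r; last lia.
by rewrite mulnC; have := cn (tag u - 1); rewrite subrK.
Qed.

Lemma blowup_connected : connected_graph blowup_graph.
Proof.
pose joined (u v : blowup) := exists s, path blowup_adj u s /\ last u s = v.
have edge u v : blowup_adj u v -> joined u v.
  by move=> uv; exists [:: v]; rewrite /= uv.
have trans v u w : joined u v -> joined v w -> joined u w.
  move=> [s [ps ls]] [s' [ps' ls']]; exists (s ++ s').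
  by rewrite cat_path last_cat ps ls ps'.
have up j (u v : blowup) : tag v = tag u + j.+1%:Z -> joined u v.
  elim: j v => [|j IH] v uv; first by apply: edge; rewrite /blowup_adj uv !inE eqxx.
  apply: (trans (Tagged (fun k => 'I_(n k)) (Ordinal (n0 (tag u + j.+1%:Z))))).
    exact: IH.
  by apply: edge; rewrite /blowup_adj uv !inE /=; lia.
have down j (u v : blowup) : tag v = tag u - j.+1%:Z -> joined u v.
  elim: j v => [|j IH] v uv.
    by apply: edge; rewrite /blowup_adj uv !inE eqxx orbT.
  apply: (trans (Tagged (fun k => 'I_(n k)) (Ordinal (n0 (tag u - j.+1%:Z))))).
    exact: IH.
  by apply: edge; rewrite /blowup_adj uv !inE /=; lia.
suff all_joined (u v : blowup) : joined u v by exact: all_joined.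
have [uv|vu|uv] := ltgtP (tag u) (tag v).
- by apply: (up `|tag v - tag u|%N.-1); lia.
- by apply: (down `|tag v - tag u|%N.-1); lia.
(* Vertices of the same level are not adjacent; the path makes a detour through the next level. *)
apply: (trans (Tagged (fun k => 'I_(n k)) (Ordinal (n0 (tag u + 1%:Z))))).
  exact: (up 0%N).
by apply: (down 0%N); rewrite /= -uv addrK.
Qed.

Lemma blowup_lazy_step (u v : blowup_graph) : lazy_step u v =
  2^-1 * (u == v)%:R + 2^-1 * (if tag v \in [:: tag u + 1; tag u - 1]
    then (c (Num.min (tag u) (tag v)))%:R / ((n (tag v))%:R * mass c (tag u)) else 0).
Proof.
have nn k : (n k)%:R != 0 :> R by rewrite pnatr_eq0 -lt0n.
rewrite /lazy_step /total_weight blowup_total_weight/= /blowup_adj.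
case: ifP => // _; congr (_ + _ * _); rewrite /blowup_weight; field.
by rewrite !nn gt_eqF ?mass_gt0.
Qed.

(* By reversibility the law at time [t] is the vertex mass times a function of
   the level, so that [chain_kernel] runs from the level of [v] to that of [x]. *)
Lemma blowup_heat_kernel (x v : blowup_graph) t : n (tag x) = 1%N ->
  heat_kernel x v t = mass c (tag v) / ((n (tag v))%:R * mass c (tag x)) *
    chain_kernel c t (tag v) (tag x).
Proof.
move=> nx.
have nn k : (n k)%:R != 0 :> R by rewrite pnatr_eq0 -lt0n.
have mm k : mass c k != 0 :> R by rewrite gt_eqF ?mass_gt0.
elim: t v => [|t IH] v /=.
  rewrite /chain_kernel/= /delta.
  have [vx|vx] := eqVneq (tag v) (tag x).
    rewrite -(singleton_level nx vx).
    by rewrite eqxx mulr1 nx mul1r divff.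
  by case: eqP => [xv|_]; [rewrite xv eqxx in vx|rewrite mulr0].
pose G k := mass c k / ((n k)%:R * mass c (tag x)) * chain_kernel c t k (tag x) : R.
set k : int := tag v; pose s : seq int := [:: k; k + 1; k - 1].
have us : uniq s by rewrite /= !inE; lia.
have step0 (z : blowup_graph) : tag z \notin s -> lazy_step z v = 0.
  rewrite !inE => zs; rewrite blowup_lazy_step.
  have -> : (z == v) = false by apply/negP => /eqP zv; move: zs; rewrite zv eqxx.
  rewrite !inE; case: ifP => [|_]; first lia.
  by rewrite !mulr0 addr0.
have F0 (z : blowup_graph) : 0 <= heat_kernel x z t * lazy_step z v.
  rewrite IH blowup_lazy_step mulr_ge0//.
    by rewrite mulr_ge0 ?chain_kernel_ge0// divr_ge0 ?mulr_ge0 ?(ltW (mass_gt0 _ _ _)).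
  rewrite addr_ge0 ?mulr_ge0//; case: ifP => // _.
  by rewrite divr_ge0 ?mulr_ge0 ?(ltW (mass_gt0 _ _ _)).
pose F (z : blowup) := @heat_kernel R blowup_graph x z t * @lazy_step R blowup_graph z v.
have -> : (\esum_(z in [set: blowup_graph]) (heat_kernel x z t * lazy_step z v)%:E =
    \esum_(z in [set z : blowup | tag z \in s]) (F z)%:E)%E.
  rewrite [RHS]esum_mkcond; apply: eq_esum => z _.
  case: ifPn => // zs; rewrite step0 ?mulr0//.
  by apply: contra zs => zs; exact/mem_set.
rewrite esum_levels//= !big_cons big_nil.
pose T l (i : 'I_(n l)) : blowup := Tagged (fun k => 'I_(n k)) i.
(* All vertices of a neighbouring level contribute equally, whereas in the level of [v] only [v]
   itself contributes, by holding. *)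
have side l a : l != k -> (forall i, @lazy_step R blowup_graph (@T l i) v = a) ->
    \sum_(i < n l) F (@T l i) = (n l)%:R * (G l * a).
  move=> lk la; rewrite (eq_bigr (fun=> G l * a)); last first.
    by move=> i _; rewrite /F IH la.
  by rewrite sumr_const card_ord mulr_natl.
have mid : \sum_(i < n k) F (@T k i) = G k / 2.
  have Tv i : (@T k i == v) = (i == tagged v).
    by rewrite eq_sym eq_Tagged eq_sym.
  have Fi i : F (@T k i) = G k / 2 * (i == tagged v)%:R.
    rewrite /F IH blowup_lazy_step !inE /= Tv.
    case: ifP => [/orP[]/eqP kE|_]; [| |by rewrite mulr0 addr0 /G -[RHS]mulrA].
      by have : k = k + 1 := kE; lia.
    by have : k = k - 1 := kE; lia.
  rewrite (bigD1 (tagged v))//= Fi eqxx mulr1 big1 ?addr0// => i iv.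
  by rewrite Fi (negPf iv) mulr0.
have Tne l i : l != k -> (@T l i == v) = false.
  by move=> lk; apply/negP => /eqP E; move: lk; rewrite /k -E eqxx.
rewrite mid.
rewrite (side (k + 1) (2^-1 * ((c k)%:R / ((n k)%:R * mass c (k + 1))))).
rewrite (side (k - 1) (2^-1 * ((c (k - 1))%:R / ((n k)%:R * mass c (k - 1))))).
- rewrite /G /step addr0 -!/(chain_kernel c t _ _); field.
  by rewrite !nn !mm.
- by lia.
- move=> i; rewrite blowup_lazy_step !inE /= Tne; last lia.
  rewrite -/k subrK eqxx/= min_l; last lia.
  by rewrite mulr0 add0r.
- by lia.
- move=> i; rewrite blowup_lazy_step !inE /= Tne; last lia.
  rewrite -/k addrK eqxx orbT min_r; last lia.
  by rewrite mulr0 add0r.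
Qed.

End Blowup.

(** * Divergence of the ratio *)

Lemma oscillating_not_cvg (R : realType) (u : nat -> R) :
  (forall n, exists T1 T2, [/\ (n <= T1)%N, (n <= T2)%N, 2 <= u T1 & u T2 <= 1 / 2]) ->
  ~ cvg (u t @[t --> \oo]).
Proof.
move=> uo /cvgrPdist_lt/(_ (1 / 2))[//|n _ ul].
(* Both values would lie within 1/2 of the limit, but they differ by at least 3/2. *)
have [T1 [T2 [n1 n2 u1 u2]]] := uo n.
have := ul T1 n1; have := ul T2 n2; rewrite /= !ltr_norml.
by move=> /andP[? ?] /andP[? ?]; lra.
Qed.

Theorem mainTheorem1 (R : realType) :
  exists (G : weighted_graph R) (x y : G),
    [/\ connected_graph G,
        bounded_weights G &
        ~ cvg ((heat_kernel x x t / heat_kernel y y t) @[t --> \oo])].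
Proof.
have [c [c0 c1 osc]] := oscillating_chain R.
(* Level [k] is given the size of its edge towards level 0 or 1. *)
pose n (k : int) := c (if 0 < k then k - 1 else k).
have n0 k : (0 < n k)%N by exact: c0.
have cn (k : int) : (c k <= n k * n (k + 1)%R)%N.
  rewrite /n; have [k0|k0] := leP 0 k.
    have -> : 0 < k + 1 by lia.
    by rewrite addrK leq_pmull.
  have -> : (0 < k) = false by lia.
  by rewrite leq_pmulr.
pose v (k : int) : blowup_graph R c0 n0 := Tagged (fun k => 'I_(n k)) (Ordinal (n0 k)).
(* This applies to levels 0 and 1, whose size is [c 0 = 1] in both cases. *)
have hk k t : n k = 1%N -> heat_kernel (v k) (v k) t = chain_kernel c t k k.
  move=> nk; rewrite blowup_heat_kernel//= nk mul1r divff ?mul1r//.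
  by rewrite gt_eqF ?mass_gt0.
exists (blowup_graph R c0 n0), (v 0), (v 1); split.
- exact: blowup_connected.
- exact: blowup_bounded.
apply: oscillating_not_cvg => m; have [T1 [T2 [m1 m2 K1 K2]]] := osc m.
exists T1, T2; rewrite !hk//; split => //.
  by rewrite ler_pdivlMr ?chain_kernel_gt0 ?subrr//; lra.
by rewrite ler_pdivrMr ?chain_kernel_gt0 ?subrr//; lra.
Qed.
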